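(* Let $p$ be a prime with $p\equiv 9 \pmod{10}$ and let $n$ be a nonnegative integer. Then for every $i\in\{1,2,\ldots,p-1\}$, $$\overline{A}_{25}(5p(pn+i))\equiv 0 \pmod{5}.$$
   Context: An overpartition of $n$ is a partition of $n$ in which the first occurrence of each distinct part may be overlined. For a positive integer $\ell$, $\overline{A}_\ell(n)$ denotes the number of overpartitions of $n$ into parts not divisible by $\ell$, with $\overline{A}_\ell(0)=1$; equivalently $$\sum_{n\ge 0}\overline{A}_\ell(n)q^n=\frac{(q^\ell;q^\ell)_\infty^2(q^2;q^2)_\infty}{(q;q)_\infty^2(q^{2\ell};q^{2\ell})_\infty},\qquad (a;q)_\infty=\prod_{k\ge 0}(1-aq^k).$$ *)

(* Defs.v *)
From mathcomp Require Import all_boot.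

Set Implicit Arguments.
Unset Strict Implicit.
Unset Printing Implicit Defensive.

(* An overpartition of n is encoded as a pair (m, O): m gives the multiplicity
   of each part of the underlying partition, and O is the set of those distinct
   parts whose first occurrence is overlined.  All parts and multiplicities are
   at most n; the index k : 'I_n stands for the part k.+1. *)
Definition is_overpartition (n : nat)
    (mO : {ffun 'I_n -> 'I_n.+1} * {set 'I_n}) : bool :=
  (\sum_(k < n) k.+1 * mO.1 k == n) && [forall k in mO.2, 0 < mO.1 k].

Definition parts_not_divisible_by (l n : nat)
    (mO : {ffun 'I_n -> 'I_n.+1} * {set 'I_n}) : bool :=
  [forall k : 'I_n, (0 < mO.1 k) ==> ~~ (l %| k.+1)].

Definition Abar (l n : nat) : nat :=
  #|[set mO : {ffun 'I_n -> 'I_n.+1} * {set 'I_n} |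
      is_overpartition mO && parts_not_divisible_by l mO]|.

(* Main.v *)
Require Import Defs.
From mathcomp Require Import all_boot.
From mathcomp Require Import all_algebra.
From mathcomp Require Import zify ring.

(** Put P(q) = prod_k (1 - q^k) / (1 + q^k), which is the theta series
    sum_n (-1)^n q^(n^2).  The generating function of [Abar 25] is
    P(q^25) / P(q), congruent to P(q)^24 = P(q)^4 (P(q)^4)^5, hence to
    T(q) T(q^5), modulo 5, where T = P^4.
    Jacobi's four and eight squares theorems read
      P^4 = 1 - 8 sum_(a, x >= 1) (-1)^(a + x) a q^(a x),
      P^8 = 1 + 16 sum_(a, x >= 1) (-1)^a a^3 q^(a x).
    The first one shows that the coefficients of P^4 at 5 n and at n agree
    modulo 5; hence [Abar 25 (5 * n)] is congruent to the n-th coefficient of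
    T^2 = P^8.  At n = p m with p prime to m, the divisors of n pair up as
    a, p a and the second formula yields the factor 1 + p^3, which vanishes
    modulo 5 since p = -1 mod 5.
    Both formulas are convolution identities between divisor sums: P^4 is
    characterized by its logarithmic derivative, and P^8 is the square of P^4.
    Both are proved by Liouville's elementary method. *)

Set Implicit Arguments.
Unset Strict Implicit.
Unset Printing Implicit Defensive.
Import GRing.Theory Num.Theory.
Local Open Scope ring_scope.

(** * Divisor pairs and quadruples with bounded entries *)

Lemma big_reindex_seq (R : Type) (idx : R) (op : Monoid.com_law idx)
    (I J : eqType) (s : seq I) (t : seq J) (P : pred I) (Q : pred J)
    (f : J -> I) (g : I -> J) (F : I -> R) :
  uniq s -> uniq t ->
  (forall u, u \in t -> Q u -> [/\ f u \in s, P (f u) & g (f u) = u]) ->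
  (forall w, w \in s -> P w -> [/\ g w \in t, Q (g w) & f (g w) = w]) ->
  \big[op/idx]_(w <- s | P w) F w = \big[op/idx]_(u <- t | Q u) F (f u).
Proof.
move=> us ut fP gP; rewrite -big_filter -[RHS]big_filter -(big_map f xpredT).
apply/perm_big/uniq_perm; first exact: filter_uniq.
  rewrite map_inj_in_uniq ?filter_uniq // => u v.
  rewrite !mem_filter => /andP[Qu tu] /andP[Qv tv] fuv.
  by have [_ _ <-] := fP u tu Qu; have [_ _ <-] := fP v tv Qv; rewrite fuv.
move=> w; rewrite mem_filter; apply/andP/mapP => [[Pw sw]|[u]].
  by have [tg Qg <-] := gP w sw Pw; exists (g w); rewrite // mem_filter Qg.
by rewrite mem_filter => /andP[Qu tu] ->; have [-> ->] := fP u tu Qu.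
Qed.

(** The bound [N] is kept apart from [n], so that one truncation order serves all coefficients of
    degree at most [N]. *)
Definition box (N : nat) : seq (nat * nat) :=
  [seq (a, x) | a <- index_iota 1 N.+1, x <- index_iota 1 N.+1].

Definition pairs (N n : nat) : seq (nat * nat) :=
  [seq u <- box N | u.1 * u.2 == n]%N.

Definition quads (N n : nat) : seq ((nat * nat) * (nat * nat)) :=
  [seq w <- [seq (u, v) | u <- box N, v <- box N]
  | w.1.1 * w.1.2 + w.2.1 * w.2.2 == n]%N.

Lemma box_uniq N : uniq (box N).
Proof. by apply: allpairs_uniq; rewrite ?iota_uniq // => -[a b] [c d]. Qed.

Lemma pairs_uniq N n : uniq (pairs N n).
Proof. exact/filter_uniq/box_uniq. Qed.

Lemma quads_uniq N n : uniq (quads N n).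
Proof.
by apply/filter_uniq/allpairs_uniq; rewrite ?box_uniq // => -[a b] [c d].
Qed.

Lemma mem_box N a x : ((a, x) \in box N) = (0 < a <= N)%N && (0 < x <= N)%N.
Proof.
apply/allpairsP/andP => [[[b y] /=]|[ha hx]].
  by rewrite !mem_index_iota !ltnS => -[hb hy [-> ->]].
by exists (a, x); rewrite /= !mem_index_iota !ltnS.
Qed.

Lemma mem_pairs N n a x : (n <= N)%N ->
  ((a, x) \in pairs N n) = [&& 0 < a, 0 < x & a * x == n]%N.
Proof. by move=> nN; rewrite mem_filter mem_box /=; nia. Qed.

Lemma mem_quads N n a x b y : (n <= N)%N ->
  (((a, x), (b, y)) \in quads N n) =
  [&& 0 < a, 0 < b, 0 < x, 0 < y & a * x + b * y == n]%N.
Proof.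
move=> nN; rewrite mem_filter /=.
have -> : (((a, x), (b, y)) \in [seq (u, v) | u <- box N, v <- box N]) =
    ((a, x) \in box N) && ((b, y) \in box N).
  apply/allpairsP/andP => [[[u v] /= [hu hv [-> ->]]]|[hu hv]] //.
  by exists ((a, x), (b, y)).
by rewrite !mem_box; nia.
Qed.

(** * Liouville's transformations of sums over a x + b y = n *)

Section Liouville.

Variables (N n : nat).
Hypothesis nN : (n <= N)%N.

Implicit Types (F G : nat -> nat -> nat -> nat -> int).

(** Quadruples are stored as ((a, x), (b, y)), while [C] and [F] take their arguments in the order
    a, b, x, y. *)
Definition quad_sum (C : nat -> nat -> nat -> nat -> bool)
    (F : nat -> nat -> nat -> nat -> int) : int :=
  \sum_(w <- quads N n | C w.1.1 w.2.1 w.1.2 w.2.2)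
     F w.1.1 w.2.1 w.1.2 w.2.2.

Local Notation allq := (quad_sum (fun _ _ _ _ => true)).
Local Notation Agt := (quad_sum (fun a b _ _ => (b < a)%N)).
Local Notation Alt := (quad_sum (fun a b _ _ => (a < b)%N)).
Local Notation Aeq := (quad_sum (fun a b _ _ => a == b)).
Local Notation Xgt := (quad_sum (fun _ _ x y => (y < x)%N)).
Local Notation Xlt := (quad_sum (fun _ _ x y => (x < y)%N)).
Local Notation Xeq := (quad_sum (fun _ _ x y => x == y)).

(** Since a x + b y = (a - b) x + b (x + y), the map (a, b, x, y) -> (a - b, b, x, x + y) stays
    among the solutions and turns b < a into x < y. *)
Lemma quad_sum_gt_lt F G :
  (forall a b x y, F (a + b)%N b x y = G a b x (x + y)%N) -> Agt F = Xlt G.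
Proof.
move=> FG; rewrite /quad_sum.
rewrite (big_reindex_seq _ (t := quads N n)
  (Q := fun w => (w.1.2 < w.2.2)%N)
  (f := fun w => ((w.1.1 + w.2.1, w.1.2), (w.2.1, w.2.2 - w.1.2))%N)
  (g := fun w => ((w.1.1 - w.2.1, w.1.2), (w.2.1, w.1.2 + w.2.2))%N));
  rewrite ?quads_uniq //=.
- apply: eq_bigr => -[[a x] [b y]] /= xy.
  by rewrite FG subnKC // ltnW.
- move=> [[a x] [b y]] /=; rewrite !mem_quads // => h xy.
  by split; [nia|lia|congr (_, _, (_, _)); lia].
- move=> [[a x] [b y]] /=; rewrite !mem_quads // => h xy.
  by split; [nia|lia|congr (_, _, (_, _)); lia].
Qed.

Lemma quad_sum_swap C F :
  quad_sum C F =
  quad_sum (fun a b x y => C b a y x) (fun a b x y => F b a y x).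
Proof.
rewrite /quad_sum (big_reindex_seq _ (t := quads N n)
  (Q := fun w => C w.2.1 w.1.1 w.2.2 w.1.2)
  (f := fun w => (w.2, w.1)) (g := fun w => (w.2, w.1)));
  rewrite ?quads_uniq //=.
- by move=> [[a x] [b y]] /=; rewrite !mem_quads // => h xy; split=> //; nia.
- by move=> [[a x] [b y]] /=; rewrite !mem_quads // => h xy; split=> //; nia.
Qed.

Lemma quad_sum_lt_gt F G :
  (forall a b x y, F a (a + b)%N x y = G a b (x + y)%N y) -> Alt F = Xgt G.
Proof.
move=> FG; rewrite quad_sum_swap [RHS]quad_sum_swap.
by apply: quad_sum_gt_lt => a b x y; rewrite addnC FG addnC.
Qed.

Lemma quad_sum_trichotomy_parts F : allq F = Agt F + Alt F + Aeq F.
Proof.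
rewrite /quad_sum (bigID (fun w => (w.2.1 < w.1.1)%N)) -addrA /=; congr (_ + _).
rewrite (bigID (fun w => (w.1.1 < w.2.1)%N)) /=.
by congr (_ + _); apply: eq_bigl => w; lia.
Qed.

Lemma quad_sum_trichotomy_mults F : allq F = Xgt F + Xlt F + Xeq F.
Proof.
rewrite /quad_sum (bigID (fun w => (w.2.2 < w.1.2)%N)) -addrA /=; congr (_ + _).
rewrite (bigID (fun w => (w.1.2 < w.2.2)%N)) /=.
by congr (_ + _); apply: eq_bigl => w; lia.
Qed.

Lemma quad_sumD C F G :
  quad_sum C (fun a b x y => F a b x y + G a b x y) =
  quad_sum C F + quad_sum C G.
Proof. exact: big_split. Qed.

Lemma quad_sumB C F G :
  quad_sum C (fun a b x y => F a b x y - G a b x y) =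
  quad_sum C F - quad_sum C G.
Proof. exact: sumrB. Qed.

Lemma eq_quad_sum C F G : (forall a b x y, F a b x y = G a b x y) ->
  quad_sum C F = quad_sum C G.
Proof. by move=> FG; apply: eq_bigr => w _; apply: FG. Qed.

(* Liouville's method: the off-diagonal parts of [u] and [v] are transported
   to [G] and [H] by the bijections (a, b, x, y) <-> (a - b, b, x, x + y) and
   (a, b, x, y) <-> (a, b - a, x + y, y), where they cancel, so that only the
   diagonals x = y and a = b survive. *)
Lemma liouville (u v G H : nat -> nat -> nat -> nat -> int)
    (K := fun a b x y => G a b x y + H b a y x) :
  (forall a b x y, v (a + b)%N b x y = G a b x (x + y)%N) ->
  (forall a b x y, u a b x (x + y)%N = G (a + b)%N b x y) ->
  (forall a b x y, v a (a + b)%N x y = H a b (x + y)%N y) ->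
  (forall a b x y, u a b (x + y)%N y = H a (a + b)%N x y) ->
  (forall a b x y, K a (a + b)%N x y = K a b (x + y)%N y) ->
  allq (fun a b x y => u a b x y - v a b x y) =
  Xeq (fun a b x y => u a b x y + K a b x y) -
  Aeq (fun a b x y => v a b x y + K a b x y).
Proof.
move=> vG uG vH uH KK.
rewrite quad_sumB (quad_sum_trichotomy_mults u) (quad_sum_trichotomy_parts v).
rewrite (quad_sum_gt_lt vG) (quad_sum_lt_gt vH).
have -> : Xlt u = Agt G by apply/esym/quad_sum_gt_lt => a b x y; rewrite uG.
have -> : Xgt u = Alt H by apply/esym/quad_sum_lt_gt => a b x y; rewrite uH.
have H1 : Alt H = Agt (fun a b x y => H b a y x) by rewrite quad_sum_swap.
have H2 : Xgt H = Xlt (fun a b x y => H b a y x) by rewrite quad_sum_swap.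
have eK : Alt K = Xgt K by apply: quad_sum_lt_gt.
have := quad_sum_trichotomy_mults K.
rewrite quad_sum_trichotomy_parts eK H1 H2 /K !quad_sumD => E.
lia.
Qed.

(** When x = y the equation becomes (a + b) x = n: a divisor pair whose first entry is cut in
    two. *)
Lemma quad_sum_eq_mults F :
  Xeq F = \sum_(u <- pairs N n) \sum_(1 <= a < u.1) F a (u.1 - a)%N u.2 u.2.
Proof.
have -> : \sum_(u <- pairs N n) \sum_(1 <= a < u.1) F a (u.1 - a)%N u.2 u.2 =
  \sum_(q <- [seq (u, a) | u <- pairs N n, a <- index_iota 1 u.1])
     F q.2 (q.1.1 - q.2)%N q.1.2 q.1.2.
  by rewrite big_allpairs_dep.
rewrite /quad_sum (big_reindex_seq _ (Q := xpredT)
  (t := [seq (u, a) | u <- pairs N n, a <- index_iota 1 u.1])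
  (f := fun q => ((q.2, q.1.2), (q.1.1 - q.2, q.1.2))%N)
  (g := fun w => ((w.1.1 + w.2.1, w.1.2), w.1.1)%N)) //=.
- exact: quads_uniq.
- apply: allpairs_uniq_dep; rewrite ?pairs_uniq //.
    by move=> u _; apply: iota_uniq.
  by move=> [u a] [v b] _ _ /= [-> ->].
- move=> _ /allpairsPdep [[d e] [a [ud ia ->]]] _ /=.
  move: ud ia; rewrite mem_pairs // mem_index_iota mem_quads //= => ud ia.
  by split; [nia|lia|congr (_, _, _); lia].
- move=> [[a x] [b y]] /=; rewrite mem_quads // => h xy.
  split=> //; last by congr (_, _, (_, _)); lia.
  apply/allpairsPdep; exists (a + b, x)%N, a.
  by rewrite mem_pairs // mem_index_iota; split=> //=; [nia|lia].
Qed.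

(** When a = b the equation becomes a (x + y) = n, and the cofactor is cut in two. *)
Lemma quad_sum_eq_parts F :
  Aeq F = \sum_(u <- pairs N n) \sum_(1 <= x < u.2) F u.1 u.1 x (u.2 - x)%N.
Proof.
have -> : \sum_(u <- pairs N n) \sum_(1 <= x < u.2) F u.1 u.1 x (u.2 - x)%N =
  \sum_(q <- [seq (u, a) | u <- pairs N n, a <- index_iota 1 u.2])
     F q.1.1 q.1.1 q.2 (q.1.2 - q.2)%N.
  by rewrite big_allpairs_dep.
rewrite /quad_sum (big_reindex_seq _ (Q := xpredT)
  (t := [seq (u, a) | u <- pairs N n, a <- index_iota 1 u.2])
  (f := fun q => ((q.1.1, q.2), (q.1.1, q.1.2 - q.2))%N)
  (g := fun w => ((w.1.1, w.1.2 + w.2.2), w.1.2)%N)) //=.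
- exact: quads_uniq.
- apply: allpairs_uniq_dep; rewrite ?pairs_uniq //.
    by move=> u _; apply: iota_uniq.
  by move=> [u a] [v b] _ _ /= [-> ->].
- move=> _ /allpairsPdep [[d e] [a [ud ia ->]]] _ /=.
  move: ud ia; rewrite mem_pairs // mem_index_iota mem_quads //= => ud ia.
  by split; [nia|lia|congr (_, _, _); lia].
- move=> [[a x] [b y]] /=; rewrite mem_quads // => h xy.
  split=> //; last by congr (_, _, (_, _)); lia.
  apply/allpairsPdep; exists (a, x + y)%N, x.
  by rewrite mem_pairs // mem_index_iota; split=> //=; [nia|lia].
Qed.

End Liouville.

(** * Two convolution identities for divisor sums *)

Lemma sgn_cases a : (-1) ^+ a = 1 :> int \/ (-1) ^+ a = -1 :> int.
Proof. by rewrite -signr_odd; case: odd; [right|left]. Qed.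

Lemma sgnB a d : (a <= d)%N -> (-1) ^+ (d - a) = (-1) ^+ d * (-1) ^+ a :> int.
Proof. by move=> ad; rewrite -signr_odd oddB // signr_addb !signr_odd. Qed.

Lemma sum_sgn d : 2 * \sum_(1 <= a < d.+1) (-1) ^+ a = (-1) ^+ d - 1 :> int.
Proof.
elim: d => [|d IHd]; first by rewrite big_geq.
by rewrite big_nat_recr //= mulrDr IHd exprS; ring.
Qed.

Lemma sum_sgn_sqr d :
  2 * \sum_(1 <= a < d.+1) (-1) ^+ a * a%:R ^+ 2 =
  (-1) ^+ d * (d%:R * (d%:R + 1)) :> int.
Proof.
elim: d => [|d IHd]; first by rewrite big_geq // mulr0 mul0r mulr0.
by rewrite big_nat_recr //= mulrDr IHd exprS -natr1; ring.
Qed.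

Definition pair_sum (N n : nat) (f : nat -> nat -> int) : int :=
  \sum_(u <- pairs N n) f u.1 u.2.

Lemma eq_pair_sum N n f g : (n <= N)%N ->
  (forall d e, f d.+1 e.+1 = g d.+1 e.+1) -> pair_sum N n f = pair_sum N n g.
Proof.
move=> nN fg; apply: eq_big_seq => -[[|d] [|e]];
  by rewrite mem_pairs //= ?andbF.
Qed.

(** Each sign is replaced by 1 and by -1 in turn, which leaves polynomial identities. *)
Local Ltac signs l :=
  rewrite ?exprD ?natrD;
  let rec go l := lazymatch l with
    | (?l', ?a) => let h := fresh in
        case: (sgn_cases a) => h; rewrite ?h; clear h; go l'
    | _ => idtac end in
  go l; ring.

(** With L = sum (-1)^(a + x) a q^(a x) and M = sum (-1)^a a^3 q^(a x), this is the coefficient of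
    q^n in 4 L^2 = M + L, which amounts to (1 - 8 L)^2 = 1 + 16 M. *)
Lemma liouville_theta8 N n : (n <= N)%N ->
  4 * quad_sum N n (fun _ _ _ _ => true)
    (fun a b x y => (-1) ^+ (a + b + x + y) * a%:R * b%:R) =
  pair_sum N n (fun d e => (-1) ^+ d * d%:R ^+ 3 + (-1) ^+ (d + e) * d%:R).
Proof.
move=> nN.
(* [u] and [v] come from 4 a b = (a + b)^2 - (a - b)^2; [G] and [H] are [v] transported by the two
   bijections. *)
pose u a b x y : int := (-1) ^+ (a + b + x + y) * (a%:R + b%:R) ^+ 2.
pose v a b x y : int := (-1) ^+ (a + b + x + y) * (a%:R - b%:R) ^+ 2.
pose G a (b x : nat) y : int := (-1) ^+ (a + y) * a%:R ^+ 2.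
pose H (a : nat) b x (y : nat) : int := (-1) ^+ (b + x) * b%:R ^+ 2.
rewrite /quad_sum mulr_sumr.
transitivity (quad_sum N n (fun _ _ _ _ => true)
  (fun a b x y => u a b x y - v a b x y)).
  by apply: eq_bigr => -[[a x] [b y]] _; rewrite /u /v /=; ring.
rewrite (liouville nN (G := G) (H := H)); first last.
- by move=> a b x y; rewrite /G /H; signs (tt, a, b, x, y).
- by move=> a b x y; rewrite /u /H; signs (tt, a, b, x, y).
- by move=> a b x y; rewrite /v /H; signs (tt, a, b, x, y).
- by move=> a b x y; rewrite /u /G; signs (tt, a, b, x, y).
- by move=> a b x y; rewrite /v /G; signs (tt, a, b, x, y).
rewrite quad_sum_eq_mults // quad_sum_eq_parts // -sumrB.
apply: (eq_pair_sum (f := fun d e =>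
  \sum_(1 <= a < d) (u a (d - a)%N e e +
    (G a (d - a)%N e e + H (d - a)%N a e e))
  - \sum_(1 <= x < e) (v d d x (e - x)%N +
    (G d d x (e - x)%N + H d d (e - x)%N x))))
  => // d e.
(* On the diagonal x = y the term [u] no longer depends on a, and [G] and [H] contribute equally. *)
have -> : \sum_(1 <= a < d.+1) (u a (d.+1 - a)%N e.+1 e.+1 +
      (G a (d.+1 - a)%N e.+1 e.+1 + H (d.+1 - a)%N a e.+1 e.+1)) =
    \sum_(1 <= a < d.+1) (-1) ^+ d.+1 * (d%:R + 1) ^+ 2 +
    (-1) ^+ e.+1 * (2 * \sum_(1 <= a < d.+1) (-1) ^+ a * a%:R ^+ 2).
  rewrite !mulr_sumr -big_split /=; apply: eq_big_nat => a /andP[_ ad].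
  rewrite /u /G /H subnKC ?(ltnW ad) // natrB ?(ltnW ad) // -natr1.
  by signs (tt, a, d.+1, e.+1).
(* On the diagonal a = b the term [v] vanishes. *)
have -> : \sum_(1 <= x < e.+1) (v d.+1 d.+1 x (e.+1 - x)%N +
      (G d.+1 d.+1 x (e.+1 - x)%N + H d.+1 d.+1 (e.+1 - x)%N x)) =
    (-1) ^+ (d.+1 + e.+1) * (d%:R + 1) ^+ 2 *
    (2 * \sum_(1 <= x < e.+1) (-1) ^+ x).
  rewrite !mulr_sumr; apply: eq_big_nat => x /andP[_ xe].
  rewrite /v /G /H !exprD !sgnB ?(ltnW xe) // -!natr1.
  by signs (tt, x, d.+1, e.+1).
rewrite sum_sgn_sqr sum_sgn sumr_const_nat subSS subn0 -mulr_natr.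
by rewrite -!natr1 !(exprS (-1)) !exprD !(exprS (-1)); signs (tt, d, e).
Qed.

(** With L as in [liouville_theta8] and S = sum (1 - (-1)^x) a q^(a x), this is the coefficient of
    q^n in 8 L S = S - 2 q L', that is, in q T' = - 4 S T for T = 1 - 8 L. *)
Lemma liouville_theta4 N n : (n <= N)%N ->
  8 * quad_sum N n (fun _ _ _ _ => true)
    (fun a b x y => (-1) ^+ (a + x) * (1 - (-1) ^+ y) * a%:R * b%:R) =
  pair_sum N n (fun d e => (1 - (-1) ^+ e) * d%:R)
  - 2 * n%:R * pair_sum N n (fun d e => (-1) ^+ (d + e) * d%:R).
Proof.
move=> nN.
pose u a b x y : int :=
  ((-1) ^+ (a + x) - (-1) ^+ (a + x + y)) * (a%:R + b%:R) ^+ 2.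
pose v a b x y : int :=
  ((-1) ^+ (a + x) - (-1) ^+ (a + x + y)) * (a%:R - b%:R) ^+ 2.
pose G a b x y : int :=
  ((-1) ^+ (a + b + x) - (-1) ^+ (a + b + y)) * a%:R ^+ 2.
pose H a b x y : int := ((-1) ^+ (a + x + y) - (-1) ^+ (a + x)) * b%:R ^+ 2.
rewrite /quad_sum mulr_sumr.
transitivity (2 * quad_sum N n (fun _ _ _ _ => true)
  (fun a b x y => u a b x y - v a b x y)).
  rewrite /quad_sum mulr_sumr.
  by apply: eq_bigr => -[[a x] [b y]] _; rewrite /u /v /= !exprD; ring.
rewrite (liouville nN (G := G) (H := H)); first last.
- by move=> a b x y; rewrite /G /H; signs (tt, a, b, x, y).
- by move=> a b x y; rewrite /u /H; signs (tt, a, b, x, y).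
- by move=> a b x y; rewrite /v /H; signs (tt, a, b, x, y).
- by move=> a b x y; rewrite /u /G; signs (tt, a, b, x, y).
- by move=> a b x y; rewrite /v /G; signs (tt, a, b, x, y).
rewrite quad_sum_eq_mults // quad_sum_eq_parts // -sumrB mulr_sumr.
(* On a divisor pair n = d e, so the factor n enters the sum and the identity can be checked one
   pair at a time. *)
have -> : 2 * n%:R * pair_sum N n (fun d e => (-1) ^+ (d + e) * d%:R) =
    pair_sum N n (fun d e => 2 * (d%:R * e%:R) * ((-1) ^+ (d + e) * d%:R)).
  rewrite mulr_sumr; apply: eq_big_seq => -[d e]; rewrite mem_pairs //=.
  by case/and3P=> _ _ /eqP <-; rewrite natrM.
rewrite -sumrB.
apply: (eq_pair_sum (f := fun d e => 2 * (
  \sum_(1 <= a < d) (u a (d - a)%N e e +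
    (G a (d - a)%N e e + H (d - a)%N a e e))
  - \sum_(1 <= x < e) (v d d x (e - x)%N +
    (G d d x (e - x)%N + H d d (e - x)%N x))))
  (g := fun d e => (1 - (-1) ^+ e) * d%:R
     - 2 * (d%:R * e%:R) * ((-1) ^+ (d + e) * d%:R)))
  => // d e.
have -> : \sum_(1 <= a < d.+1) (u a (d.+1 - a)%N e.+1 e.+1 +
      (G a (d.+1 - a)%N e.+1 e.+1 + H (d.+1 - a)%N a e.+1 e.+1)) =
    ((-1) ^+ e.+1 - 1) * (d%:R + 1) ^+ 2 * (\sum_(1 <= a < d.+1) (-1) ^+ a) +
    (1 - (-1) ^+ e.+1) * (-1) ^+ d.+1 *
    (\sum_(1 <= a < d.+1) (-1) ^+ a * a%:R ^+ 2).
  rewrite !mulr_sumr -big_split /=; apply: eq_big_nat => a /andP[_ ad].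
  rewrite /u /G /H !exprD !sgnB ?(ltnW ad) // natrB ?(ltnW ad) // -natr1.
  by signs (tt, a, d.+1, e.+1).
have -> : \sum_(1 <= x < e.+1) (v d.+1 d.+1 x (e.+1 - x)%N +
      (G d.+1 d.+1 x (e.+1 - x)%N + H d.+1 d.+1 (e.+1 - x)%N x)) =
    \sum_(1 <= x < e.+1) (-1) ^+ (d.+1 + e.+1) * (d%:R + 1) ^+ 2 +
    (d%:R + 1) ^+ 2 * (1 - (-1) ^+ e.+1 - (-1) ^+ (d.+1 + e.+1)) *
    (\sum_(1 <= x < e.+1) (-1) ^+ x).
  rewrite !mulr_sumr -big_split /=; apply: eq_big_nat => x /andP[_ xe].
  rewrite /v /G /H !exprD !sgnB ?(ltnW xe) // -!natr1.
  by signs (tt, x, d.+1, e.+1).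
rewrite sumr_const_nat subSS subn0 -mulr_natr.
rewrite mulrBr !mulrDr !(mulrCA 2) sum_sgn_sqr !sum_sgn.
rewrite -!natr1 !(exprS (-1)) !exprD !(exprS (-1)); signs (tt, d, e).
Qed.

(** * Polynomials as truncated power series *)

Section TruncatedSeries.

Variables (R : comNzRingType) (N : nat).
Implicit Types p q r : {poly R}.

(** Congruence modulo X^(N + 1). *)
Definition eqm p q := forall i, (i <= N)%N -> p`_i = q`_i.

Lemma eq_eqm p q : p = q -> eqm p q.
Proof. by move=> ->. Qed.

Lemma eqm_refl p : eqm p p.
Proof. by []. Qed.

Lemma eqm_sym p q : eqm p q -> eqm q p.
Proof. by move=> pq i iN; rewrite pq. Qed.

Lemma eqm_trans q p r : eqm p q -> eqm q r -> eqm p r.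
Proof. by move=> pq qr i iN; rewrite pq ?qr. Qed.

Lemma eqmD p p' q q' : eqm p p' -> eqm q q' -> eqm (p + q) (p' + q').
Proof. by move=> pp qq i iN; rewrite !coefD pp ?qq. Qed.

Lemma eqmB p p' q q' : eqm p p' -> eqm q q' -> eqm (p - q) (p' - q').
Proof. by move=> pp qq i iN; rewrite !coefB pp ?qq. Qed.

Lemma eqmM p p' q q' : eqm p p' -> eqm q q' -> eqm (p * q) (p' * q').
Proof.
move=> pp qq i iN; rewrite !coefM; apply: eq_bigr => j _.
by rewrite pp ?qq // (leq_trans _ iN) ?leq_subr // -ltnS.
Qed.

Lemma eqmX p q n : eqm p q -> eqm (p ^+ n) (q ^+ n).
Proof.
move=> pq; elim: n => [|n IHn]; first by rewrite !expr0.
by rewrite !exprS; apply: eqmM.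
Qed.

Lemma eqm_prod (I : Type) (s : seq I) (P : pred I) (F G : I -> {poly R}) :
  (forall i, P i -> eqm (F i) (G i)) ->
  eqm (\prod_(i <- s | P i) F i) (\prod_(i <- s | P i) G i).
Proof. by move=> FG; elim/big_ind2: _ => // *; apply: eqmM. Qed.

Lemma eqm_Xn p n : (N < n)%N -> eqm (p * 'X^n) 0.
Proof. by move=> Nn i iN; rewrite coefMXn coef0 (leq_ltn_trans iN). Qed.

(** A factor with constant term 1 is a unit among power series; it is cancelled degree by degree. *)
Lemma eqm_mulIr (d : {poly R}) p q : d`_0 = 1 -> eqm (p * d) (q * d) -> eqm p q.
Proof.
move=> d0 pq; elim/ltn_ind => i IHi iN.
have := pq i iN; rewrite !coefM !big_ord_recr /= subnn d0 !mulr1.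
rewrite (eq_bigr (fun j : 'I_i => q`_j * d`_(i - j))) => [/addrI //|j _].
by rewrite IHi // (leq_trans _ iN) // ltnW.
Qed.

(** The Euler operator q d/dq, not a theta series. *)
Definition theta p := 'X * p^`().

Lemma coef_theta p i : (theta p)`_i = p`_i *+ i.
Proof. by rewrite coefXM coef_deriv; case: i. Qed.

Lemma thetaB p q : theta (p - q) = theta p - theta q.
Proof. by rewrite /theta derivB mulrBr. Qed.

Lemma thetaM p q : theta (p * q) = theta p * q + p * theta q.
Proof. by rewrite /theta derivM; ring. Qed.

Lemma theta_exp p n : theta (p ^+ n.+1) = n.+1%:R * p ^+ n * theta p.
Proof.
elim: n => [|n IHn]; first by rewrite expr1 expr0 !mul1r.
by rewrite exprS thetaM IHn -[n.+2%:R]natr1 exprS; ring.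
Qed.

(** Logarithmic derivatives add up over a product; [e i] is that of [f i], stated without
    division. *)
Lemma theta_prod (I : Type) (s : seq I) (f e : I -> {poly R}) :
  (forall i, eqm (theta (f i)) (f i * e i)) ->
  eqm (theta (\prod_(i <- s) f i)) ((\prod_(i <- s) f i) * \sum_(i <- s) e i).
Proof.
move=> fe; elim: s => [|k s IHs].
  by rewrite !big_nil mulr0 /theta derivC mulr0.
rewrite !big_cons thetaM.
apply: (eqm_trans (eqmD (eqmM (fe k) (eqm_refl _)) (eqmM (eqm_refl _) IHs))).
by apply: eq_eqm; ring.
Qed.

(** The values c = -1 and c = 1 give the numerator and the denominator of P. *)
Definition euler (c : R) : {poly R} := \prod_(1 <= k < N.+1) (1 + c *: 'X^k).

Lemma euler_coef0 c : (euler c)`_0 = 1.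
Proof.
rewrite -horner_coef0 horner_prod big_nat big1 // => -[|k] //= _.
by rewrite hornerD hornerC hornerZ hornerXn expr0n mulr0 addr0.
Qed.

End TruncatedSeries.

(** In degree i the equation reads i p_i = sum_(j < i) p_j e_(i - j), so each p_i vanishes by
    induction, the integers being torsion-free. *)
Lemma theta_ode (N : nat) (p e : {poly int}) :
  p`_0 = 0 -> e`_0 = 0 -> eqm N (theta p) (p * e) -> eqm N p 0.
Proof.
move=> p0 e0 pe; elim/ltn_ind => -[|i] IHi iN; rewrite coef0 //.
have := pe i.+1 iN.
rewrite coef_theta coefM big_ord_recr /= subnn e0 mulr0 addr0.
rewrite big1 => [/eqP|j _]; first by rewrite mulrn_eq0 => /eqP.
by rewrite IHi ?coef0 ?mul0r // (leq_trans _ iN) // ltnW.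
Qed.

(** * Lambert series and Jacobi's theorems *)

Definition series (N : nat) (f : nat -> nat -> int) : {poly int} :=
  \sum_(u <- box N) f u.1 u.2 *: 'X^(u.1 * u.2).

Lemma coef_series N f n : (series N f)`_n = pair_sum N n f.
Proof.
rewrite coef_sum /pair_sum big_filter [RHS]big_mkcond; apply: eq_bigr => u _.
by rewrite coefZ coefXn eq_sym mulr_natr mulrb.
Qed.

Lemma coef_seriesM N f g n : (series N f * series N g)`_n =
  quad_sum N n (fun _ _ _ _ => true) (fun a b x y => f a x * g b y).
Proof.
rewrite /series big_distrlr coef_sum /quad_sum big_filter [RHS]big_mkcond.
rewrite big_allpairs; apply: eq_bigr => u _.
rewrite coef_sum; apply: eq_bigr => v _ /=.
rewrite -scalerAl -scalerAr scalerA -exprD coefZ coefXn eq_sym.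
by rewrite mulr_natr mulrb.
Qed.

Lemma series_coef0 N f : (series N f)`_0 = 0.
Proof.
rewrite coef_series /pair_sum big1_seq // => -[a x]; rewrite mem_pairs //=.
by case/and3P; case: a => // a; case: x.
Qed.

(** With Y = - c q^k, the factor 1 - Y has logarithmic derivative - k Y / (1 - Y) = - k (Y + Y^2 +
    ...). *)
Lemma theta_euler N (c : int) : eqm N (theta (euler N c))
  (euler N c * series N (fun a x => - (- c) ^+ x * a%:R)).
Proof.
have -> : series N (fun a x => - (- c) ^+ x * a%:R) =
    \sum_(1 <= k < N.+1)
       \sum_(1 <= x < N.+1) (- (- c) ^+ x * k%:R) *: 'X^(k * x).
  by rewrite /series big_allpairs.
apply: theta_prod => -[|k].
  rewrite big1 => [|x _]; last by rewrite mulr0 scale0r.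
  by rewrite mulr0 /theta expr0 alg_polyC -polyCD derivC mulr0.
pose Y : {poly int} := (- c) *: 'X^(k.+1).
have -> : 1 + c *: 'X^(k.+1) = 1 - Y by rewrite /Y scaleNr opprK.
have -> : \sum_(1 <= x < N.+1) (- (- c) ^+ x * k.+1%:R) *: 'X^(k.+1 * x) =
    - k.+1%:R * \sum_(1 <= x < N.+1) Y ^+ x.
  rewrite mulr_sumr; apply: eq_bigr => x _.
  rewrite exprZn -exprM mulNr scaleNr -scalerA scaler_nat mulNr mulr_natl.
  by rewrite scalerMnr.
have tel M : (1 - Y) * \sum_(1 <= x < M.+1) Y ^+ x = Y - Y ^+ M.+1.
  elim: M => [|M IHM]; first by rewrite big_geq // mulr0 expr1 subrr.
  by rewrite big_nat_recr //= mulrDr IHM (exprS _ M.+1); ring.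
rewrite mulrCA tel.
have -> : theta (1 - Y) = - k.+1%:R * Y.
  rewrite /theta derivB derivC sub0r derivZ derivXn mulrN mulNr; congr (- _).
  by rewrite /Y -scalerAr mulrnAr -exprS mulr_natl scalerMnr.
(* What is left is the tail of the geometric series, a multiple of Y^(N + 1), of degree above
   [N]. *)
rewrite mulrBr -[X in eqm N X _]addr0; apply/eqmD => //.
rewrite -mulNr opprK exprZn -exprM -scalerAr scalerAl.
by apply/eqm_sym/eqm_Xn; nia.
Qed.

(* [theta4] and [theta8] are P^4 and P^8 in the notation of the header. *)
Definition theta4 N : {poly int} :=
  1 - 8%:R * series N (fun a x => (-1) ^+ (a + x) * a%:R).

Definition theta8 N : {poly int} :=
  1 + 16%:R * series N (fun a _ => (-1) ^+ a * a%:R ^+ 3).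

Lemma theta4_sqr N : eqm N (theta4 N ^+ 2) (theta8 N).
Proof.
move=> n nN; rewrite /theta4 /theta8.
set L := series N _; set M := series N _.
have -> : (1 - 8%:R * L) ^+ 2 = 1 - 16%:R * L + 64%:R * (L * L) by ring.
rewrite !coefD !coefN -!polyC_natr !coefCM coef_seriesM !coef_series -addrA.
congr (_ + _).
have := liouville_theta8 nN.
rewrite /pair_sum big_split /=.
set A := \sum_(u <- _) _; set B := \sum_(u <- _) _ => E.
have -> : quad_sum N n (fun _ _ _ _ => true)
    (fun a b x y => (-1) ^+ (a + x) * a%:R * ((-1) ^+ (b + y) * b%:R)) =
  quad_sum N n (fun _ _ _ _ => true)
    (fun a b x y => (-1) ^+ (a + b + x + y) * a%:R * b%:R).
  by apply: eq_quad_sum => a b x y; rewrite !exprD; ring.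
by move: (quad_sum _ _ _ _) E => Q E; lia.
Qed.

(** Four times [liouville_theta4], read as a logarithmic derivative. *)
Lemma theta_theta4 N : eqm N (theta (theta4 N))
  (theta4 N * (- 4%:R * series N (fun a x => (1 - (-1) ^+ x) * a%:R))).
Proof.
move=> n nN; rewrite coef_theta /theta4.
set L := series N _; set M := series N _.
have -> : (1 - 8%:R * L) * (- 4%:R * M) = 32%:R * (L * M) - 4%:R * M by ring.
rewrite !coefD !coefN -!polyC_natr !coefCM coef_seriesM !coef_series coef1.
have := liouville_theta4 nN.
have -> : quad_sum N n (fun _ _ _ _ => true)
    (fun a b x y => (-1) ^+ (a + x) * a%:R * ((1 - (-1) ^+ y) * b%:R)) =
  quad_sum N n (fun _ _ _ _ => true)
    (fun a b x y => (-1) ^+ (a + x) * (1 - (-1) ^+ y) * a%:R * b%:R).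
  by apply: eq_quad_sum => a b x y; ring.
(* The constant term 1 lives at n = 0, where the factor n kills it. *)
have -> : ((n == 0%N)%:R - 8%:R * pair_sum N n
      (fun a x => (-1) ^+ (a + x) * a%:R)) *+ n =
    - 8%:R * (n%:R * pair_sum N n (fun a x => (-1) ^+ (a + x) * a%:R)).
  by rewrite -mulr_natl; case: n {nN} => [|n] /=; ring.
move: (quad_sum _ _ _ _) (pair_sum _ _ _) => Q A.
by rewrite -[2 * _ * _]mulrA; move: (n%:R * _) => B E; lia.
Qed.

(* Both sides have the same logarithmic derivative, since
   4 (theta (euler (-1)) / euler (-1) - theta (euler 1) / euler 1) is the
   logarithmic derivative of [theta4] computed in [theta_theta4]. *)
Lemma theta4_euler N : eqm N (euler N (-1) ^+ 4) (theta4 N * euler N 1 ^+ 4).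
Proof.
set E := euler N (-1); set D := euler N 1; set T := theta4 N.
pose e := series N (fun a x => - (- -1) ^+ x * a%:R).
pose d := series N (fun a x => - (-1) ^+ x * a%:R).
have hE : eqm N (theta E) (E * e) := @theta_euler N (-1).
have hD : eqm N (theta D) (D * d) := @theta_euler N 1.
have hT : eqm N (theta T) (T * (4%:R * (e - d))).
  have -> : 4%:R * (e - d) =
      - 4%:R * series N (fun a x => (1 - (-1) ^+ x) * a%:R).
    rewrite mulNr -mulrN; congr (_ * _); rewrite /e /d /series -sumrB -sumrN.
    apply: eq_bigr => u _; rewrite -scalerBl -scaleNr opprK expr1n.
    by congr (_ *: _); ring.
  exact: theta_theta4.
have : eqm N (E ^+ 4 - T * D ^+ 4) 0.
  apply: (@theta_ode N _ (4%:R * e)).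
  - rewrite !exprS expr0 mulr1 coefB !coef0M !euler_coef0 coefB -polyC_natr.
    by rewrite coefCM series_coef0 mulr0 coef1 subr0 !mulr1 subrr.
  - by rewrite -polyC_natr coefCM series_coef0 mulr0.
  rewrite thetaB (thetaM T) !(theta_exp _ 3).
  apply: (@eqm_trans _ _ (4%:R * E ^+ 3 * (E * e) -
    (T * (4%:R * (e - d)) * D ^+ 4 + T * (4%:R * D ^+ 3 * (D * d))))).
    apply: eqmB; first exact: eqmM.
    by apply: eqmD; [apply: eqmM | apply: eqmM => //; apply: eqmM].
  by apply: eq_eqm; ring.
move=> h i iN; have /eqP := h i iN.
by rewrite coefB coef0 subr_eq0 => /eqP.
Qed.

(** * The generating function of overpartitions *)

Lemma big_nat_dvd (R : Type) (idx : R) (op : Monoid.law idx) (l n : nat)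
    (F : nat -> R) : (0 < l)%N ->
  \big[op/idx]_(1 <= k < n.+1 | (l %| k)%N) F k =
  \big[op/idx]_(1 <= j < (n %/ l).+1) F (l * j)%N.
Proof.
move=> l0; elim: n => [|n IHn]; first by rewrite div0n !big_geq.
rewrite big_mkcond big_nat_recr //= -big_mkcond IHn divnS //.
case: ifP => [dvdl|_]; last by rewrite Monoid.mulm1 add0n.
rewrite add1n [RHS]big_nat_recr //=; congr (op _ (F _)).
by rewrite -{1}(divnK dvdl) divnS // dvdl add1n mulnC.
Qed.

Section Overpartitions.

Variable R : comNzRingType.

(** Counts the ways of using [j] copies of the part [k]: the 2 is the choice of overlining the first
    copy or not. *)
Definition over_weight (l k j : nat) : R :=
  if j == 0%N then 1 else if (l %| k)%N then 0 else 2.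

Definition over_factor (l N k : nat) : {poly R} :=
  \sum_(j < N.+1) over_weight l k j *: 'X^(k * j).

Definition over_gf (l N : nat) : {poly R} :=
  \prod_(1 <= k < N.+1) over_factor l N k.

(** Expanding the product gives a sum over multiplicities m. The weights of m multiply to 2 to the
    number of parts that occur, which counts the sets O, or to 0 once a part divisible by [l]
    occurs. *)
Lemma Abar_coef l n : (Abar l n)%:R = (over_gf l n)`_n.
Proof.
rewrite /over_gf big_add1 big_mkord /over_factor /= bigA_distr_bigA coef_sum.
rewrite /Abar -sum1_card natr_sum.
transitivity (\sum_(m : {ffun 'I_n -> 'I_n.+1}) \sum_(O : {set 'I_n} |
    is_overpartition (m, O) && parts_not_divisible_by l (m, O)) (1 : R)).
  by rewrite pair_big_dep /=; apply: eq_bigl => -[m O]; rewrite inE.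
apply: eq_bigr => m _.
rewrite scaler_prod prodrXr coefZ coefXn /is_overpartition /=.
rewrite eq_sym; case: eqP => _ /=; last by rewrite big_pred0 ?mulr0.
rewrite mulr1 /parts_not_divisible_by /=; case: forallP => [ndiv|div].
  rewrite (eq_bigl (fun O : {set 'I_n} => O \in powerset [set k | 0 < m k]%N)).
    rewrite sumr_const card_powerset natrX -prodr_const.
    rewrite [LHS]big_mkcond; apply: eq_bigr => k _; rewrite inE /over_weight.
    by have := ndiv k; case: (nat_of_ord (m k)) => //= j /negbTE ->.
  move=> O; rewrite andbT powersetE; apply/forallP/subsetP => h k.
    by move=> kO; have := h k; rewrite kO inE.
  by apply/implyP => kO; have := h k kO; rewrite inE.
have [k] : exists k : 'I_n, ~~ ((0 < m k)%N ==> ~~ (l %| k.+1)%N).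
  by apply/existsP; rewrite -negb_forall; apply/negP => /forallP.
rewrite negb_imply negbK => /andP[mk lk].
rewrite big_pred0 => [|O]; last by rewrite andbF.
by rewrite (bigD1 k) //= /over_weight -if_neg -lt0n mk lk mul0r.
Qed.

(** If [l] does not divide [k], the factor truncates 1 + 2 (q^k + q^(2k) + ...) = (1 + q^k) / (1 -
    q^k); otherwise it is 1. *)
Lemma over_factor_mul l N k : (0 < k)%N ->
  eqm N ((1 - 'X^k) * over_factor l N k)
    (if (l %| k)%N then 1 - 'X^k else 1 + 'X^k).
Proof.
move=> k0; rewrite /over_factor big_ord_recl /over_weight /=.
rewrite muln0 expr0 scale1r.
case: ifP => _.
  by rewrite big1 ?addr0 ?mulr1 // => j _; rewrite scale0r.
have -> : \sum_(i < N) 2 *: 'X^(k * bump 0 i) =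
    2 * 'X^k * \sum_(i < N) ('X^k : {poly R}) ^+ i.
  rewrite mulr_sumr; apply: eq_bigr => i _; rewrite /bump add1n mulnS exprD.
  by rewrite exprM -mulrA scaler_nat mulr_natl.
have := subrX1 ('X^k : {poly R}) N; rewrite -exprM.
move: (\sum_(i < N) _) => S h.
apply: (@eqm_trans _ _ (1 + 'X^k - 2 * 'X^(k * N.+1))).
  by apply: eq_eqm; rewrite mulnS exprD -[X in _ * (_ * X)](subrK 1) h; ring.
rewrite -[X in eqm N _ X]subr0; apply: eqmB => //.
by apply: eqm_Xn; nia.
Qed.

Lemma euler_comp N l (c : R) :
  euler N c \Po 'X^l = \prod_(1 <= k < N.+1) (1 + c *: 'X^(l * k)).
Proof.
rewrite /euler rmorph_prod; apply: eq_bigr => k _.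
by rewrite /= comp_polyD comp_polyC comp_polyZ comp_Xn_poly -exprM.
Qed.

(** After the substitution, the factors with l k > N are 1 up to degree [N]. *)
Lemma euler_dvd N l (c : R) : (0 < l)%N ->
  eqm N (\prod_(1 <= k < N.+1 | (l %| k)%N) (1 + c *: 'X^k))
    (euler N c \Po 'X^l).
Proof.
move=> l0; rewrite big_nat_dvd // euler_comp.
rewrite [X in eqm N _ X](@big_cat_nat _ _ _ (N %/ l).+1) //=; last first.
  by rewrite ltnS leq_div.
rewrite -[X in eqm N X _]mulr1; apply: eqmM => //; apply: eqm_sym.
apply: (@eqm_trans _ _ (\prod_((N %/ l).+1 <= k < N.+1) 1)); last first.
  by rewrite big1_eq.
rewrite big_nat [X in eqm N _ X]big_nat; apply: eqm_prod => k /andP[lk _].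
rewrite -[X in eqm N _ X]addr0; apply: eqmD => //.
by rewrite -mul_polyC; apply: eqm_Xn; rewrite mulnC -ltn_divLR.
Qed.

(** The product formula P(q^l) / P(q), with denominators cleared. *)
Lemma over_gf_euler l N : (0 < l)%N ->
  eqm N (over_gf l N * euler N (-1) * (euler N 1 \Po 'X^l))
    (euler N 1 * (euler N (-1) \Po 'X^l)).
Proof.
move=> l0.
apply: (@eqm_trans _ _ (\prod_(1 <= k < N.+1)
     (if (l %| k)%N then 1 - 'X^k else 1 + 'X^k)
   * \prod_(1 <= k < N.+1 | (l %| k)%N) (1 + 1 *: 'X^k))).
  apply: eqmM; last by apply/eqm_sym/euler_dvd.
  rewrite /over_gf /euler -big_split /= big_nat [X in eqm N _ X]big_nat.
  apply: eqm_prod => k /andP[k0 _]; rewrite scaleN1r mulrC.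
  exact: over_factor_mul.
apply: (@eqm_trans _ _ (euler N 1 *
    \prod_(1 <= k < N.+1 | (l %| k)%N) (1 + (-1) *: 'X^k))); last first.
  by apply: eqmM => //; apply: euler_dvd.
apply: eq_eqm; rewrite /euler !(big_mkcond (fun k => (l %| k)%N)) /=.
rewrite -!big_split /=; apply: eq_bigr => k _.
by case: ifP => _; rewrite scale1r ?scaleN1r; ring.
Qed.

End Overpartitions.

(** * Reduction of the generating function modulo 5 *)

Lemma pchar_poly_F5 : 5 \in [pchar {poly 'F_5}].
Proof. by rewrite inE /= -polyC_natr pchar_Fp_0. Qed.

Lemma F5_exp5 (c : 'F_5) : c ^+ 5 = c.
Proof. by case: c => -[|[|[|[|[|c]]]]] // lt_c; apply/val_inj. Qed.

(** Frobenius is additive and fixes the coefficients. *)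
Lemma F5_poly_exp5 (p : {poly 'F_5}) : p ^+ 5 = p \Po 'X^5.
Proof.
rewrite -(pFrobenius_autE pchar_poly_F5) -{1}[p]coefK poly_def rmorph_sum.
rewrite comp_polyE; apply: eq_bigr => i _.
by rewrite /= pFrobenius_autE exprZn F5_exp5 -!exprM mulnC.
Qed.

Definition theta4_F5 N : {poly 'F_5} := map_poly intr (theta4 N).

Lemma map_euler N (c : int) :
  map_poly intr (euler N c) = euler N c%:~R :> {poly 'F_5}.
Proof.
rewrite rmorph_prod; apply: eq_bigr => k _.
by rewrite /= rmorphD rmorph1 /= map_polyZ map_polyXn.
Qed.

Lemma eqm_map N (p q : {poly int}) :
  eqm N p q -> eqm N (map_poly intr p : {poly 'F_5}) (map_poly intr q).
Proof. by move=> pq i iN; rewrite !coef_map /= pq. Qed.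

(** Substituting q^25 is taking the 25th power, so the product formula becomes A = (E / D)^24, and
    E^4 = T D^4 turns this into T^6 = T T^5. *)
Lemma over_gf25 N :
  eqm N (over_gf 'F_5 25 N) (theta4_F5 N * (theta4_F5 N \Po 'X^5)).
Proof.
set A := over_gf _ _ _; set T := theta4_F5 N.
pose E : {poly 'F_5} := euler N (-1); pose D : {poly 'F_5} := euler N 1.
have ET : eqm N (E ^+ 4) (T * D ^+ 4).
  have := eqm_map (@theta4_euler N).
  by rewrite [map_poly _ (theta4 N * _)]rmorphM !rmorphXn /= !map_euler.
have comp25 (p : {poly 'F_5}) : p \Po 'X^25 = p ^+ 25.
  rewrite -[25%N]/(5 * 5)%N (exprM p) (F5_poly_exp5 p) (F5_poly_exp5 (p \Po _)).
  by rewrite -comp_polyA comp_Xn_poly -exprM.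
have AE : eqm N (A * E * D ^+ 25) (D * E ^+ 25).
  by rewrite -(comp25 D) -(comp25 E); apply: over_gf_euler.
have X1 (p : {poly 'F_5}) n : p`_0 = 1 -> (p ^+ n)`_0 = 1.
  move=> p0; elim: n => [|n IHn]; first by rewrite expr0 coef1.
  by rewrite exprS coef0M p0 IHn mulr1.
have DE0 : (D * E)`_0 = 1 by rewrite coef0M !euler_coef0 mulr1.
have {}AE : eqm N (A * D ^+ 24) (E ^+ 24).
  apply: (eqm_mulIr DE0).
  have -> : A * D ^+ 24 * (D * E) = A * E * D ^+ 25 by ring.
  by have -> : E ^+ 24 * (D * E) = D * E ^+ 25 by ring.
have D0 : (D ^+ 24)`_0 = 1 by apply/X1/euler_coef0.
rewrite -F5_poly_exp5; apply: (eqm_mulIr D0); apply: (eqm_trans AE).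
have -> : E ^+ 24 = (E ^+ 4) ^+ 6 by rewrite -exprM.
have -> : T * T ^+ 5 * D ^+ 24 = (T * D ^+ 4) ^+ 6 by ring.
exact: eqmX.
Qed.

(** * Divisor sums modulo 5 and the congruence *)

(** Pairs (a, x) with 5 dividing a contribute 0. In the others of product 5 m, 5 divides the
    cofactor, and (a, 5 x) <-> (a, x) keeps the sign since x and 5 x have the same parity. *)
Lemma theta4_F5_mul5 N m : (5 * m <= N)%N ->
  (theta4_F5 N)`_(5 * m) = (theta4_F5 N)`_m.
Proof.
move=> mN; have mN' : (m <= N)%N by lia.
rewrite !coef_map /theta4 !coefB -polyC_natr !coefCM !coef_series !coef1.
rewrite muln_eq0 /= !rmorphB !rmorphM /=; congr (_ - _ * _).
have drop k f :
    (pair_sum N k f)%:~R = \sum_(u <- pairs N k) (f u.1 u.2)%:~R :> 'F_5.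
  exact: rmorph_sum.
rewrite !drop (bigID (fun u => 5 %| u.1)%N).
rewrite [RHS](bigID (fun u => 5 %| u.1)%N) /=.
have kill k : \sum_(u <- pairs N k | (5 %| u.1)%N)
   ((-1) ^+ (u.1 + u.2) * u.1%:R)%:~R = 0 :> 'F_5.
  apply: big1 => u /dvdnP[a ->].
  by rewrite rmorphM /= rmorph_nat natrM pchar_Fp_0 // !mulr0.
rewrite !kill !add0r.
rewrite (big_reindex_seq _ (t := pairs N m) (Q := fun u => ~~ (5 %| u.1)%N)
  (f := fun u => (u.1, 5 * u.2)%N) (g := fun u => (u.1, u.2 %/ 5)%N)) /=;
  rewrite ?pairs_uniq //.
- apply: eq_bigr => u _; congr (_%:~R); congr (_ * _).
  by rewrite -signr_odd oddD oddM -oddD signr_odd.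
- move=> [a x] /=; rewrite !mem_pairs // => h na.
  by split=> //; [nia|rewrite mulKn].
- move=> [a x] /=; rewrite !mem_pairs // => /and3P[a0 x0 /eqP ax] na.
  have x5 : (5 %| x)%N.
    have : (5 %| a * x)%N by rewrite ax dvdn_mulr.
    by rewrite Euclid_dvdM // (negbTE na).
  case/dvdnP: x5 => y ex; subst x.
  by rewrite mulnK //; split=> //; [nia|rewrite mulnC].
Qed.

Lemma theta8_prime N p m : prime p -> (p %% 10 = 9)%N -> ~~ (p %| m)%N ->
  (p * m <= N)%N -> ((theta8 N)`_(p * m))%:~R = 0 :> 'F_5.
Proof.
move=> p_pr p9 pm mN; have p0 := prime_gt0 p_pr.
have m0 : (0 < m)%N by case: m pm {mN} => //; rewrite dvdn0.
rewrite /theta8 coefD -polyC_natr coefCM coef_series coef1.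
rewrite (gtn_eqF (_ : 0 < p * m)%N) ?muln_gt0 ?p0 // add0r rmorphM /=.
suff -> : (pair_sum N (p * m) (fun a _ => (-1) ^+ a * a%:R ^+ 3))%:~R = 0
    :> 'F_5.
  by rewrite mulr0.
rewrite rmorph_sum (bigID (fun u => p %| u.1)%N) /=.
(* As p does not divide m, the pairs (p a, x) match the pairs (a, p x) with p not dividing a. *)
rewrite (big_reindex_seq _ (t := pairs N (p * m))
  (Q := fun u => ~~ (p %| u.1)%N)
  (f := fun u => (p * u.1, u.2 %/ p)%N)
  (g := fun u => (u.1 %/ p, p * u.2)%N)) /=;
  rewrite ?pairs_uniq //.
- rewrite -big_split big1 //= => u _.
  (* p is odd because p = 9 mod 10. *)
  have -> : (-1) ^+ (p * u.1) = (-1) ^+ u.1 :> int.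
    by rewrite -signr_odd oddM (_ : odd p) ?signr_odd //; lia.
  have -> : (p * u.1)%:R = p%:R * u.1%:R :> int by rewrite natrM.
  rewrite -rmorphD /= -mulrDr exprMn -[X in _ + X]mul1r -mulrDl mulrCA.
  rewrite rmorphM /=.
  rewrite (_ : (p%:R ^+ 3 + 1)%:~R = 0) ?mul0r //.
  rewrite rmorphD rmorphXn /= rmorph_nat.
  rewrite (_ : p%:R = - 1 :> 'F_5); first by apply/eqP.
  rewrite -(@Fp_nat_mod 5) // (_ : p %% 5 = 4)%N; last by lia.
  by apply/val_inj.
- move=> [a x] /=; rewrite !mem_pairs // => /and3P[a0 x0 /eqP ax] na.
  have xp : (p %| x)%N.
    have : (p %| a * x)%N by rewrite ax dvdn_mulr.
    by rewrite Euclid_dvdM // (negbTE na).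
  case/dvdnP: xp => y ex; subst x; rewrite mulnK // mulKn // dvdn_mulr //.
  by split=> //; [nia | rewrite mulnC].
- move=> [a x] /=; rewrite !mem_pairs // => /and3P[a0 x0 /eqP ax] /dvdnP[b eb].
  subst a; rewrite mulnK // mulKn //.
  have bx : (b * x = m)%N.
    by apply/eqP; rewrite -(eqn_pmul2l p0); apply/eqP; lia.
  have nb : ~~ (p %| b)%N.
    by apply: contra pm => pb; rewrite -bx dvdn_mulr.
  by split=> //; [nia | rewrite mulnC].
Qed.

(** In T(q^5) T(q) at degree 5 m only the indices 5 j of the first factor contribute, each T_j T_(5
    (m - j)) = T_j T_(m - j); the sum is the coefficient of T^2 at m. *)
Lemma Abar25_mul5 m : (Abar 25 (5 * m))%:R = ((theta8 (5 * m))`_m)%:~R :> 'F_5.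
Proof.
set N := (5 * m)%N; have mN : (m <= N)%N by rewrite /N; lia.
rewrite Abar_coef (over_gf25 (leqnn N)) mulrC coefM.
set T := theta4_F5 N.
transitivity (\sum_(i < m.+1) T`_i * T`_(m - i)).
  rewrite -(big_mkord xpredT (fun i => (T \Po 'X^5)`_i * T`_(N - i))).
  rewrite -(big_mkord xpredT (fun i => T`_i * T`_(m - i))).
  (* The index 0 is split off because [big_nat_dvd] starts at 1. *)
  rewrite big_ltn // [RHS]big_ltn // !subn0 coef_comp_poly_Xn //= div0n.
  rewrite theta4_F5_mul5 //; congr (_ + _).
  transitivity (\sum_(1 <= k < N.+1 | (5 %| k)%N) T`_(k %/ 5) * T`_(N - k)).
    rewrite [RHS]big_mkcond; apply: eq_bigr => k _.
    by rewrite coef_comp_poly_Xn //; case: ifP; rewrite ?mul0r.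
  rewrite big_nat_dvd // mulKn //; apply: eq_big_nat => j /andP[_ jm].
  by rewrite mulKn // -mulnBr theta4_F5_mul5 // /N; lia.
by rewrite -coefM -expr2 -rmorphXn coef_map /= (theta4_sqr mN).
Qed.

Local Close Scope ring_scope.

Theorem theorem7 (p n i : nat) (p_prime : prime p) (p_mod : p = 9 %[mod 10])
  (i_range : 1 <= i <= p - 1) :
  Abar 25 (5 * p * (p * n + i)) = 0 %[mod 5].
Proof.
have nM : ~~ (p %| p * n + i).
  by rewrite dvdn_addr ?dvdn_mulr // gtnNdvd //; lia.
(* Isolating the factor 5 leads to the coefficient of P^8 at p (p n + i). *)
rewrite -mulnA; have := Abar25_mul5 (p * (p * n + i)).
rewrite theta8_prime // ?leq_pmull // => /(congr1 val).
by rewrite /= val_Fp_nat.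
Qed.
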